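(* Let $F_m$ be the free group of rank $m\ge 2$ with a finite generating set $X$. Let $\gamma_1,\dots,\gamma_n\in F_m$ be nontrivial elements with $\|\gamma_j\|_X\le d$ for all $j$. Then $$\mathrm{lcm}_{F_m,X}(\gamma_1,\dots,\gamma_n)\le 6dn^2.$$
   Context: For a group $\Gamma$ with finite generating set $X$, $\|\cdot\|_X$ denotes word length with respect to $X$. For a finite set $S$ of nontrivial elements of $\Gamma$, let $L_S=\bigcap_{\gamma\in S}\overline{\langle\gamma\rangle}$, where $\overline{\langle\gamma\rangle}$ is the normal closure in $\Gamma$ of the cyclic subgroup generated by $\gamma$. Let $\mathrm{LCM}_{\Gamma,X}(S)$ be the set of nontrivial elements of $L_S$ of minimal word length among nontrivial elements of $L_S$. Define $\mathrm{lcm}_{\Gamma,X}(S)=\|\delta\|_X$ for any $\delta\in\mathrm{LCM}_{\Gamma,X}(S)$ if this set is nonempty, and $\mathrm{lcm}_{\Gamma,X}(S)=0$ if it is empty. Write $\mathrm{lcm}_{\Gamma,X}(\gamma_1,\dots,\gamma_n)=\mathrm{lcm}_{\Gamma,X}(\{\gamma_1,\dots,\gamma_n\})$. *)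

(* Defs.v *)
From HB Require Import structures.
From mathcomp Require Import all_boot.
From mathcomp Require Import boolp classical_sets cardinality.

Set Implicit Arguments.
Unset Strict Implicit.
Unset Printing Implicit Defensive.

Local Open Scope classical_set_scope.
Local Open Scope group_scope.

Section GroupDefs.
Variable G : groupType.
Implicit Types (A H N S X : set G) (g x y : G).

Definition is_subgroup H : Prop :=
  [/\ H 1, forall x y, H x -> H y -> H (x * y) & forall x, H x -> H x^-1].

Definition is_normal_subgroup N : Prop :=
  is_subgroup N /\ forall x g, N x -> N (x ^ g).

Definition subgroup_gen A : set G := smallest is_subgroup A.

Definition normal_closure A : set G := smallest is_normal_subgroup A.

Definition generating_set X : Prop := subgroup_gen X = setT.

Definition word_over X (w : seq G) : Prop :=
  forall x, x \in w -> X x \/ X x^-1.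

Definition has_word_of_size X g (k : nat) : Prop :=
  exists w : seq G, [/\ word_over X w, size w = k & \prod_(x <- w) x = g].

(* The default value 0 is only taken when g is outside the subgroup generated
   by X, so never when X is a generating set. *)
Definition word_length X g : nat :=
  match pselect (exists k, `[< has_word_of_size X g k >]) with
  | left ex => ex_minn ex
  | right _ => 0%N
  end.

Definition lcm_subgroup S : set G :=
  \bigcap_(g in S) normal_closure (subgroup_gen [set g]).

Definition LCM X S : set G :=
  [set delta | [/\ lcm_subgroup S delta, delta <> 1 &
     forall eta, lcm_subgroup S eta -> eta <> 1 ->
       (word_length X delta <= word_length X eta)%N]].

(* All elements of LCM X S have the same word length, so the choice made by
   cid is immaterial. *)
Definition lcm_length X S : nat :=
  match pselect (exists delta, LCM X S delta) with
  | left ex => word_length X (sval (cid ex))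
  | right _ => 0%N
  end.

End GroupDefs.

Definition free_basis (I : Type) (F : groupType) (b : I -> F) : Prop :=
  forall (H : groupType) (f : I -> H),
    exists2 phi : {multiplicative F -> H}, phi \o b =1 f &
      forall psi : {multiplicative F -> H}, psi \o b =1 f -> psi =1 phi.

Definition free_of_rank (m : nat) (F : groupType) : Prop :=
  exists b : 'I_m -> F, free_basis b.

(* Main.v *)
Require Import Defs.
From HB Require Import structures.
From mathcomp Require Import all_boot all_algebra.
From mathcomp Require Import boolp classical_sets cardinality.
From mathcomp Require Import ring zify.

(** Let N be a normal subgroup: [~ a, b] lies in N as soon as a or b does. A
balanced tree of commutators with leaves gamma_1, ..., gamma_n thus lies in every
normal closure, and its length is quadratic in n. It remains to keep it
nontrivial: given nontrivial a and b, one of b and the b ^ x (x in X) does not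
commute with a. This follows from two facts about F: commutation is transitive
on nontrivial elements, and no nontrivial element commutes with all its
conjugates. Both are computations with 2 x 2 matrices in the representation of F
over Z[t] sending the i-th basis element to 1 + t v_i w_i, where v_i = (i, 1)^T
and w_i = (1, -i). Since w_i v_i = 0 and w_j v_i <> 0 for i <> j, the product of
the syllables 1 + z t v_i w_i of a reduced word has a computable leading term in
t, which shows that the lower left entry of every nontrivial element is nonzero;
in particular that element is not mapped to a scalar matrix. *)

Set Implicit Arguments.
Unset Strict Implicit.
Unset Printing Implicit Defensive.

Import GRing.Theory.

(** * Word length with respect to a generating set *)

Section WordLength.
Local Open Scope group_scope.
Variables (G : groupType) (X : set G).
Hypothesis genX : generating_set X.
Implicit Types g h x : G.

Lemma has_word_of_sizeM g h k l :
  has_word_of_size X g k -> has_word_of_size X h l ->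
  has_word_of_size X (g * h) (k + l).
Proof.
move=> [v [Xv <- <-]] [w [Xw <- <-]]; exists (v ++ w).
split; rewrite ?size_cat ?big_cat // => x.
by rewrite mem_cat => /orP[/Xv|/Xw].
Qed.

Lemma has_word_of_sizeV g k :
  has_word_of_size X g k -> has_word_of_size X g^-1 k.
Proof.
move=> [w [Xw <- <-]]; exists (rev [seq x^-1 | x <- w]); split.
- move=> x; rewrite mem_rev => /mapP[y /Xw Xy ->].
  by rewrite invgK; case: Xy; [right|left].
- by rewrite size_rev size_map.
- elim: w {Xw} => [|x w IH]; first by rewrite !big_nil invg1.
  by rewrite /= rev_cons big_cons invgM -cats1 big_cat big_seq1 IH.
Qed.

(** The elements spelled by some word over [X] form a subgroup containing [X]. *)
Lemma has_word_of_size_ex g : exists k, has_word_of_size X g k.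
Proof.
have: subgroup_gen X g by rewrite (genX : subgroup_gen X = setT).
move/(_ [set h | exists k, has_word_of_size X h k]%classic); apply.
split=> [|x Xx].
  split; first by exists 0, [::]; rewrite big_nil.
    by move=> x y [k xk] [l yl]; exists (k + l)%N; apply: has_word_of_sizeM.
  by move=> x [k xk]; exists k; apply: has_word_of_sizeV.
exists 1%N, [:: x]; split; rewrite ?big_seq1 // => y.
by rewrite inE => /eqP->; left.
Qed.

Lemma word_lengthP g : has_word_of_size X g (word_length X g).
Proof.
rewrite /word_length; case: pselect => [ex|nex].
  by case: ex_minnP => k /asboolP.
by case: nex; have [k gk] := has_word_of_size_ex g; exists k; apply/asboolP.
Qed.

Lemma word_length_le g k : has_word_of_size X g k -> word_length X g <= k.
Proof.
move=> gk; rewrite /word_length; case: pselect => // ex.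
by case: ex_minnP => l _; apply; apply/asboolP.
Qed.

Lemma word_lengthM g h :
  word_length X (g * h) <= word_length X g + word_length X h.
Proof. by apply/word_length_le/has_word_of_sizeM; apply: word_lengthP. Qed.

Lemma word_lengthV g : word_length X g^-1 <= word_length X g.
Proof. by apply/word_length_le/has_word_of_sizeV/word_lengthP. Qed.

Lemma word_length_gen x : X x -> word_length X x <= 1.
Proof.
move=> Xx; apply: word_length_le; exists [:: x]; split; rewrite ?big_seq1 // => y.
by rewrite inE => /eqP->; left.
Qed.

Lemma word_length_gt0 g : g <> 1 -> 0 < word_length X g.
Proof.
move=> g1; have [w [_ sw gE]] := word_lengthP g.
rewrite -sw lt0n; apply/negP => /nilP w0; apply: g1.
by rewrite -gE w0 big_nil.
Qed.

Lemma word_lengthJ g h :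
  word_length X (g ^ h) <= word_length X g + 2 * word_length X h.
Proof.
apply: leq_trans (word_lengthM h^-1 (g * h)) _.
have := word_lengthM g h; have := word_lengthV h; lia.
Qed.

Lemma word_lengthR g h :
  word_length X [~ g, h] <= 2 * (word_length X g + word_length X h).
Proof.
apply: leq_trans (word_lengthM g^-1 (g ^ h)) _.
have := word_lengthV g; have := word_lengthJ g h; lia.
Qed.

(** By minimality when [LCM X S] has an element; otherwise the default value 0 makes the bound
    trivial. *)
Lemma lcm_length_le (S : set G) g : lcm_subgroup S g -> g <> 1 ->
  lcm_length X S <= word_length X g.
Proof.
move=> Sg g1; rewrite /lcm_length; case: pselect => // ex.
by case: cid => /= h [_ _ ]; apply.
Qed.

End WordLength.

(** * Balanced commutators and the quadratic length bound *)

Section BalancedCommutator.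
Local Open Scope group_scope.
Variables (G : groupType) (X : set G).
Hypothesis genX : generating_set X.

Hypothesis noncommuting_conj : forall a b : G, a <> 1 -> b <> 1 ->
  ~ commute a b \/ exists2 x, X x & ~ commute a (b ^ x).

(* Subtracting 4d makes the bound survive the recursion
   L(n) <= 2 L(floor(n/2)) + 2 L(ceil(n/2)) + 4. *)
Lemma balanced_commutator d (s : seq G) : 0 < size s ->
  (forall g, g \in s -> g <> 1 /\ word_length X g <= d) ->
  exists e : G, [/\ e <> 1, word_length X e + 4 * d <= 6 * d * size s ^ 2 &
    forall (N : set G) g, is_normal_subgroup N -> g \in s -> N g -> N e].
Proof.
have [k] := ubnP (size s); elim: k s => // k IH s sk s0 sd.
have [s1|s2] := leqP (size s) 1.
  case: s {sk} s0 s1 sd => [|g [|h s]] //= _ _ sd.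
  have [g1 gd] := sd g (mem_head _ _).
  by exists g; split=> // [|N h _]; [rewrite /=; lia|rewrite inE => /eqP->].
set p := (size s)./2.
have pE := odd_double_half (size s); rewrite -/p -addnn in pE.
have sb : odd (size s) <= 1 by case: odd.
have st : size (take p s) = p by rewrite size_takel //; lia.
have sD : size (drop p s) = size s - p by rewrite size_drop.
have [|||a [a1 al aN]] := IH (take p s); rewrite ?st; try lia.
  by move=> g /mem_take; apply: sd.
have [|||b [b1 bl bN]] := IH (drop p s); rewrite ?sD; try lia.
  by move=> g /mem_drop; apply: sd.
(* Replacing [b] by [b ^ x] costs at most 2 letters and stays in every normal subgroup containing
   [b]. *)
have [y [yl bNy aCy]] : exists y, [/\ word_length X y <= word_length X b + 2,
    forall N, is_normal_subgroup N -> N b -> N y & ~ commute a y].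
  have [abC|[x Xx abC]] := noncommuting_conj a1 b1.
    by exists b; split=> //; rewrite leq_addr.
  exists (b ^ x); split=> [|N [_ NJ]|]; [|exact: NJ|by []].
  have := word_lengthJ genX b x; have := word_length_gen Xx; lia.
(* The final estimate leaves a slack of 6d - 4, which is nonnegative only for positive [d]. *)
have d0 : 0 < d.
  case: s s0 sd {sk s2 p pE sb st sD al aN bl bN IH} => // g s _ sd.
  have [g1 gd] := sd g (mem_head _ _).
  exact: leq_trans (word_length_gt0 genX g1) gd.
exists [~ a, y]; split; first by move/eqP/commgP.
  have := word_lengthR genX a y.
  rewrite sD st in al bl.
  (* With q = size s - p, 2 (p^2 + q^2) = (p + q)^2 + (q - p)^2, and the halves differ by at most
     1. *)
  have E : 2 * (6 * d * p ^ 2 + 6 * d * (size s - p) ^ 2) <=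
      6 * d * size s ^ 2 + 6 * d.
    have -> : size s - p = (odd (size s) + p)%N by lia.
    by rewrite -[in leqRHS]pE; case: odd; nia.
  lia.
move=> N g nN; rewrite -[s in g \in s](cat_take_drop p) mem_cat.
have [[_ NM NV] NJ] := nN.
case/orP=> [/aN Na /(Na _ nN) Nae|/bN Nb /(Nb _ nN)/(bNy _ nN) Ny].
  by rewrite commgEl; apply: NM; [apply: NV|apply: NJ].
by rewrite commgEr; apply: NM => //; apply/NJ/NV.
Qed.

End BalancedCommutator.

(** * Integer powers in a group *)

Section IntegerPowers.
Local Open Scope group_scope.

Definition expgz (G : groupType) (g : G) (z : int) : G :=
  match z with Posz n => g ^+ n | Negz n => g ^- n.+1 end.

Lemma expgzS (G : groupType) (g : G) z : expgz g (1 + z)%R = g * expgz g z.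
Proof.
case: z => [n|[|n]]; [exact: expgS|by rewrite /= mulgV|].
have -> : (1 + Negz n.+1 = Negz n)%R by lia.
by rewrite /= (expgSr _ n.+1) invgM mulVKg.
Qed.

Lemma expgzP (G : groupType) (g : G) z : expgz g (-1 + z)%R = g^-1 * expgz g z.
Proof. by rewrite -[z in RHS](addKr 1%R) addrCA expgzS mulKg. Qed.

Lemma expgzD (G : groupType) (g : G) y z :
  expgz g (y + z)%R = expgz g y * expgz g z.
Proof.
elim/int_rec: y => [|n IH|n IH]; first by rewrite add0r mul1g.
  by rewrite -[n.+1]add1n PoszD -addrA !expgzS IH mulgA.
by rewrite -[n.+1]add1n PoszD opprD -addrA !expgzP IH mulgA.
Qed.

Lemma gmulf_expgz (G H : groupType) (f : UMagmaMorphism.type G H) g z :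
  f (expgz g z) = expgz (f g) z.
Proof. by case: z => n; [exact: gmulfXn|exact: gmulfXVn]. Qed.

End IntegerPowers.

(** * The generated subgroup as a group type *)

Section GeneratedSubgroup.
Local Open Scope group_scope.
Variables (G : groupType) (A : set G).

(** Packaged as a type so that it can be the target of the universal property of a free basis. *)
Record generated := Generated {
  generated_val :> G;
  _ : `[< subgroup_gen A generated_val >]
}.

HB.instance Definition _ := [isSub for generated_val].
HB.instance Definition _ := [Choice of generated by <:].

Fact generated_closed : group_closed (fun g => `[< subgroup_gen A g >]).
Proof.
split=> [|g h]; first by apply/asboolP => H [[]].
move=> /asboolP Ag /asboolP Ah; apply/asboolP => H HA.
have [[_ HM HV] _] := HA; apply: HM; first exact: Ag.
by apply: HV; apply: Ah.
Qed.

HB.instance Definition _ :=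
  SubChoice_isSubGroup.Build G (fun g => `[< subgroup_gen A g >])
    generated generated_closed.

End GeneratedSubgroup.

(** * Reduced words over a free basis *)

Section FreeNormalForm.
Local Open Scope group_scope.
Variables (F : groupType) (I : eqType) (b : I -> F).

(** The universal property maps [F] to the subgroup generated by the basis. Followed by the
    inclusion, this map fixes the basis, so by uniqueness it is the identity. *)
Lemma free_basis_generates : free_basis b -> generating_set (range b).
Proof.
move=> free_b; apply/seteqP; split=> // g _.
have bP i : `[< subgroup_gen (range b) (b i) >].
  by apply/asboolP => H [_]; apply; exists i.
have [phi phib _] := free_b _ (fun i => Generated (bP i)).
have [id' _ uniq_id] := free_b _ b.
pose incl : {multiplicative generated (range b) -> F} := val.
have <- : val (phi g) = g.
  transitivity (id' g); last by apply/esym/(uniq_id idfun).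
  by apply: (uniq_id (incl \o phi)) => i; have /(congr1 val) := phib i.
by case: (phi g) => h /= /asboolP.
Qed.

Definition syllables_prod (s : seq (I * int)) : F :=
  \prod_(x <- s) expgz (b x.1) x.2.

Definition reduced (s : seq (I * int)) : bool :=
  sorted (fun x y => x.1 != y.1) s && all (fun x => x.2 != 0%R) s.

(** A new power is put in front, or merged with a first syllable of the same index, which disappears
    if the exponents cancel. *)
Lemma reduced_cons i z s : reduced s -> exists2 s', reduced s' &
  syllables_prod s' = expgz (b i) z * syllables_prod s.
Proof.
have [->|z0] := eqVneq z 0%R; first by exists s; rewrite // mul1g.
case: s => [|[j y] s] red_s.
  exists [:: (i, z)]; first by rewrite /reduced /= z0.
  by rewrite /syllables_prod big_seq1 big_nil mulg1.
have [ij|ij] := eqVneq i j; last first.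
  exists [:: (i, z), (j, y) & s]; last by rewrite [LHS]big_cons.
  by move: red_s; rewrite /reduced /= ij z0.
rewrite -ij in red_s *.
have [zy0|zy0] := eqVneq (z + y)%R 0%R.
  exists s; last by rewrite [X in _ * X]big_cons mulgA -expgzD zy0 mul1g.
  by case/andP: red_s => /= /path_sorted ps /andP[_ als]; rewrite /reduced ps.
exists ((i, z + y)%R :: s); last first.
  by rewrite /syllables_prod !big_cons mulgA -expgzD.
case/andP: red_s => ps /= /andP[_ als]; rewrite /reduced /= zy0 als !andbT.
by case: s ps {als}.
Qed.

Lemma reduced_form : generating_set (range b) ->
  forall g, exists2 s, reduced s & g = syllables_prod s.
Proof.
move=> gen_b g; have [_ [w [wb _ <-]]] := has_word_of_size_ex gen_b g.
elim: w wb => [|x w IH] wb; first by exists [::]; rewrite // /syllables_prod !big_nil.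
have [|s red_s sE] := IH; first by move=> y yw; apply: wb; rewrite inE yw orbT.
have [i [z xE]] : exists i z, x = expgz (b i) z.
  case: (wb x (mem_head _ _)) => [] [i _ bi]; exists i; first by exists 1%R.
  by exists (-1)%R; rewrite /= bi invgK.
have [s' red_s' s'E] := reduced_cons i z red_s.
by exists s' => //; rewrite big_cons sE xE.
Qed.

End FreeNormalForm.

(** * The unit group of a ring, which provides GL_2 as a group type *)

Section UnitGroup.
Local Open Scope ring_scope.
Variable R : unitRingType.

Record units := Units { units_val :> R; _ : units_val \is a GRing.unit }.

HB.instance Definition _ := [isSub for units_val].
HB.instance Definition _ := [Choice of units by <:].

Definition units_one : units := Units (unitr1 R).
Definition units_inv (x : units) : units :=
  Units (etrans (unitrV (units_val x)) (valP x)).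
Definition units_mul (x y : units) : units :=
  Units (etrans (unitrMl _ (valP y)) (valP x)).

Fact units_mulA : associative units_mul.
Proof. by move=> x y z; apply: val_inj; apply: mulrA. Qed.
Fact units_mul1 : left_id units_one units_mul.
Proof. by move=> x; apply: val_inj; apply: mul1r. Qed.
Fact units_mulr1 : right_id units_one units_mul.
Proof. by move=> x; apply: val_inj; apply: mulr1. Qed.
Fact units_mulV : left_inverse units_one units_inv units_mul.
Proof. by move=> x; apply: val_inj; apply: mulVr; apply: valP. Qed.
Fact units_mulVr : right_inverse units_one units_inv units_mul.
Proof. by move=> x; apply: val_inj; apply: mulrV; apply: valP. Qed.

HB.instance Definition _ := isGroup.Build units
  units_mulA units_mul1 units_mulr1 units_mulV units_mulVr.

Lemma units_valM (x y : units) : val (x * y)%g = val x * val y.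
Proof. by []. Qed.

End UnitGroup.

(** * Commutation of 2 x 2 matrices, and transvections *)

Section TwoByTwo.
Local Open Scope ring_scope.
Variable R : idomainType.
Implicit Types (A B C : 'M[R]_2) (c t : R).

(** Subtracts [k] times a known equation from the goal; repeated use leaves an identity for
    [ring]. *)
Lemma eqr_lin (k x y u v : R) : u = v -> x - k * u = y - k * v -> x = y.
Proof. by move=> -> /addIr. Qed.

Lemma mul_mx2E A B i j : (A * B) i j = A i 0 * B 0 j + A i 1 * B 1 j.
Proof.
rewrite mxE !big_ord_recl big_ord0 addr0.
by congr (_ * _ + _ * _); congr (_ _ _); apply: val_inj.
Qed.

Lemma mx2P A B : A 0 0 = B 0 0 -> A 0 1 = B 0 1 -> A 1 0 = B 1 0 ->
  A 1 1 = B 1 1 -> A = B.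
Proof.
move=> e00 e01 e10 e11; apply/matrixP => i j.
have I2 (k : 'I_2) : k = 0 \/ k = 1.
  by case: k => -[|[|//]] h; [left|right]; apply: val_inj.
by case: (I2 i) => ->; case: (I2 j) => ->.
Qed.

(** Scalar matrices are central, so only the vectors (A 0 0 - A 1 1, A 0 1, A 1 0) matter; the
    equations say that those of [A] and [B] have zero 2 x 2 minors. *)
Lemma mx2_commute A B : A * B = B * A <->
  [/\ A 0 1 * B 1 0 = B 0 1 * A 1 0,
      (A 0 0 - A 1 1) * B 1 0 = A 1 0 * (B 0 0 - B 1 1) &
      (A 0 0 - A 1 1) * B 0 1 = A 0 1 * (B 0 0 - B 1 1)].
Proof.
split=> [eAB|[e1 e2 e3]].
  have E i j := congr1 (fun M : 'M[R]_2 => M i j) eAB.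
  have := E 0 0; have := E 0 1; have := E 1 0; rewrite !mul_mx2E => e10 e01 e00.
  split; [apply: (eqr_lin (k := 1) e00)|apply: (eqr_lin (k := -1) e10)|
          apply: (eqr_lin (k := 1) e01)]; ring.
apply: mx2P; rewrite !mul_mx2E;
  [apply: (eqr_lin (k := 1) e1)|apply: (eqr_lin (k := 1) e3)|
   apply: (eqr_lin (k := -1) e2)|apply: (eqr_lin (k := -1) e1)]; ring.
Qed.

(** The vectors of [A] and [C] are both proportional to that of [B], which is nonzero; cancelling
    [B 1 0] makes their own minors vanish. *)
Lemma mx2_commute_trans A B C : B 1 0 != 0 ->
  A * B = B * A -> B * C = C * B -> A * C = C * A.
Proof.
move=> b0 /mx2_commute[a1 a2 a3] /mx2_commute[c1 c2 c3]; apply/mx2_commute.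
split; apply: (mulfI b0).
- by apply: (eqr_lin (k := C 1 0) a1); apply: (eqr_lin (k := A 1 0) c1); ring.
- by apply: (eqr_lin (k := C 1 0) a2); apply: (eqr_lin (k := A 1 0) c2); ring.
- apply: (mulfI b0); apply: (eqr_lin (k := B 1 0 * C 0 1) a2).
  apply: (eqr_lin (k := - A 1 0 * (B 0 0 - B 1 1)) c1).
  apply: (eqr_lin (k := B 0 1 * A 1 0) c2).
  by apply: (eqr_lin (k := - B 1 0 * (C 0 0 - C 1 1)) a1); ring.
Qed.

(* nilp c = v w with v = (c, 1)^T and w = (1, -c), so that w v = 0. *)
Definition nilp c : 'M[R]_2 :=
  \matrix_(i, j) ((if i == 0 then c else 1) * (if j == 0 then 1 else - c)).

Lemma nilpE c : [/\ nilp c 0 0 = c, nilp c 0 1 = - c ^+ 2, nilp c 1 0 = 1 & nilp c 1 1 = - c].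
Proof. by split; rewrite mxE /=; ring. Qed.

Definition transvection c t : 'M[R]_2 := 1 + t *: nilp c.

Lemma transvectionE c t : [/\ transvection c t 0 0 = 1 + t * c,
  transvection c t 0 1 = - t * c ^+ 2, transvection c t 1 0 = t &
  transvection c t 1 1 = 1 - t * c].
Proof. by have [e1 e2 e3 e4] := nilpE c; split; rewrite !mxE /=; ring. Qed.

Lemma transvectionD c t u :
  transvection c (t + u) = transvection c t * transvection c u.
Proof.
have [a1 a2 a3 a4] := transvectionE c t.
have [b1 b2 b3 b4] := transvectionE c u.
have [c1 c2 c3 c4] := transvectionE c (t + u).
by apply: mx2P; rewrite mul_mx2E ?a1 ?a2 ?a3 ?a4 ?b1 ?b2 ?b3 ?b4 ?c1 ?c2 ?c3 ?c4;
  ring.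
Qed.

Lemma transvection0 c : transvection c 0 = 1.
Proof. by rewrite /transvection scale0r addr0. Qed.

Lemma transvection_unit c t : transvection c t \is a GRing.unit.
Proof.
by apply/unitrP; exists (transvection c (- t)); rewrite -!transvectionD
  ?addrN ?addNr transvection0.
Qed.

Lemma transvectionV c t : (transvection c t)^-1 = transvection c (- t).
Proof.
apply: (mulrI (transvection_unit c t)).
by rewrite divrr ?transvection_unit // -transvectionD addrN transvection0.
Qed.

(** The conjugate with c = 0 forces [A] to be lower triangular with equal diagonal entries; the one
    with c = 1 then kills [A 1 0]. *)
Lemma commute_transvection_conj A t : 2%:R != 0 :> R -> t != 0 ->
  (forall c, c = 0 \/ c = 1 ->
     let B := transvection c (- t) * (A * transvection c t) in
     A * B = B * A) -> A 1 0 = 0.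
Proof.
move=> two0 t0 AC; have := AC 0 (or_introl erefl); have := AC 1 (or_intror erefl).
rewrite /= !mx2_commute.
have [a1 a2 a3 a4] := transvectionE 0 t.
have [b1 b2 b3 b4] := transvectionE 0 (- t).
have [c1 c2 c3 c4] := transvectionE 1 t.
have [d1 d2 d3 d4] := transvectionE 1 (- t).
rewrite !mul_mx2E a1 a2 a3 a4 b1 b2 b3 b4 c1 c2 c3 c4 d1 d2 d3 d4.
move=> [e1 _ _] [_ f2 f3].
have A01 : A 0 1 = 0.
  have /eqP : 2%:R * t * A 0 1 ^+ 2 = 0.
    by apply: (eqr_lin (k := -1) f3); ring.
  by rewrite !mulf_eq0 (negPf two0) (negPf t0) /= orbb => /eqP.
have A11 : A 0 0 = A 1 1.
  apply: subr0_eq.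
  have /eqP : t * (A 0 0 - A 1 1) ^+ 2 = 0.
    by apply: (eqr_lin (k := -1) f2); rewrite A01; ring.
  by rewrite !mulf_eq0 (negPf t0) /= orbb => /eqP.
have /eqP : t ^+ 2 * A 1 0 ^+ 2 = 0.
  by apply: (eqr_lin (k := 1) e1); rewrite A01 A11; ring.
by rewrite !mulf_eq0 (negPf t0) /= orbb => /eqP.
Qed.

End TwoByTwo.


(** * The representation of the free group over Z[t] *)

Section FreeRepresentation.
Local Open Scope ring_scope.

Let K := {poly int}.

Definition basis_image (i : nat) : units 'M[K]_2 :=
  Units (transvection_unit (i%:Z%:P : K) 'X).

Lemma expgz_basis_image i z :
  val (expgz (basis_image i) z) = transvection (i%:Z%:P) (z%:P * 'X).
Proof.
have trX n : val (basis_image i ^+ n)%g = transvection (i%:Z%:P) (n%:Z%:P * 'X).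
  elim: n => [|n IH]; first by rewrite mul0r transvection0.
  rewrite expgS units_valM IH -transvectionD.
  by rewrite -[n.+1]add1n PoszD polyCD mulrDl mul1r.
case: z => n; first exact: trX.
rewrite -[LHS]/((val (basis_image i ^+ n.+1)%g)^-1) trX.
by rewrite transvectionV NegzE polyCN mulNr.
Qed.

(* The first column of a product of L reduced syllables has degree L in 'X, with
   leading coefficients proportional to v_i = (i, 1), where i indexes the leftmost
   syllable: the next factor multiplies the leading column by z (w_j v_i), where
   w_j v_i = i - j <> 0. *)
Lemma reduced_leading_coef (I : eqType) (e : I -> nat) (s : seq (I * int)) i z :
  injective e -> reduced ((i, z) :: s) ->
  let A := val (syllables_prod (basis_image \o e) ((i, z) :: s)) in
  exists2 t : int, t != 0 &
    [/\ (A 0 0)`_(size s).+1 = t * (e i)%:Z, (A 1 0)`_(size s).+1 = t,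
        forall l, ((size s).+1 < l)%N -> (A 0 0)`_l = 0 &
        forall l, ((size s).+1 < l)%N -> (A 1 0)`_l = 0].
Proof.
move=> inj_e; elim: s i z => [|[j y] s IH] i z red_s A.
  exists z; first by case/and3P: red_s.
  rewrite /A /syllables_prod big_seq1 expgz_basis_image /=.
  have [-> _ -> _] := transvectionE (e i)%:Z%:P (z%:P * 'X : K).
  rewrite mulrAC; split=> [||[|[|l]]|[|[|l]]] //; rewrite ?coefD ?coefMX ?coef1 //=.
  - by rewrite -polyCM coefC add0r.
  - by rewrite coefC.
  - by rewrite -polyCM coefC.
  - by rewrite coefC.
have [ij z0 red_js] : [/\ i != j, z != 0 & reduced ((j, y) :: s)].
  case/andP: red_s => /= /andP[ij ps] /and3P[-> y0 als].
  by rewrite /reduced /= ps y0 als.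
have [t t0] := IH j y red_js.
set B := val _ => -[B0 B1 lB0 lB1].
have AE : A = transvection ((e i)%:Z%:P) (z%:P * 'X) * B.
  by rewrite /A /syllables_prod big_cons units_valM expgz_basis_image.
have [a00 a01 a10 a11] := transvectionE (e i)%:Z%:P (z%:P * 'X : K).
(* The row (1, - e i) applied to the first column of [B] gives B 0 0 - (e i) B 1 0; its multiples by
   z 'X and (e i, 1)^T are added to that column. *)
have A00 : A 0 0 =
    B 0 0 + (z * (e i)%:Z)%:P * (B 0 0 - (e i)%:Z%:P * B 1 0) * 'X.
  by rewrite AE mul_mx2E a00 a01 polyCM; ring.
have A10 : A 1 0 = B 1 0 + z%:P * (B 0 0 - (e i)%:Z%:P * B 1 0) * 'X.
  by rewrite AE mul_mx2E a10 a11; ring.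
exists (z * (t * ((e j)%:Z - (e i)%:Z))).
  rewrite !mulf_neq0 // subr_eq0; apply: contraNneq ij => -[/inj_e->].
  exact: eqxx.
rewrite A00 A10; split=> [||[|l] // ll|[|l] // ll];
  rewrite coefD coefMX /= coefCM coefB coefCM.
- by rewrite lB0 // B0 B1; ring.
- by rewrite lB1 // B0 B1; ring.
- by rewrite !lB0 ?lB1 ?(ltnW ll) //; ring.
- by rewrite !lB1 ?lB0 ?(ltnW ll) //; ring.
Qed.

Lemma free_representation (I : eqType) (e : I -> nat) (F : groupType)
    (b : I -> F) :
  injective e -> free_basis b ->
  exists2 phi : UMagmaMorphism.type F (units 'M[K]_2),
    forall i, phi (b i) = basis_image (e i) &
    forall g, g <> 1%g -> val (phi g) 1 0 != 0.
Proof.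
move=> inj_e free_b; have [f fb _] := free_b _ (basis_image \o e).
(* Multiplicativity makes [f 1] idempotent, hence trivial in a group, so [f] can be repackaged as a
   morphism preserving 1. *)
have f1 : f 1%g = 1%g.
  by apply: (mulgI (f 1%g)); rewrite -gmulfM !mulg1.
pose phi : UMagmaMorphism.type F (units 'M[K]_2) :=
  HB.pack (f : F -> units _)
    (isUMagmaMorphism.Build F (units 'M[K]_2) f (f1, @gmulfM _ _ f)).
have phib i : phi (b i) = basis_image (e i) by exact: fb.
exists phi => // g g1.
have [s red_s gE] := reduced_form (free_basis_generates free_b) g.
have -> : phi g = syllables_prod (basis_image \o e) s.
  rewrite gE /syllables_prod gmulf_prod; apply: eq_bigr => x _.
  by rewrite gmulf_expgz phib.
case: s red_s gE => [|[i z] s] red_s gE.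
  by case: g1; rewrite gE /syllables_prod big_nil.
have [t t0 [_ c1 _ _]] := reduced_leading_coef inj_e red_s.
by apply: contraNneq t0 => A0; rewrite -c1 A0 coef0.
Qed.

End FreeRepresentation.

(** * Commutation in free groups of rank at least 2 *)

Section FreeCommutation.
Local Open Scope group_scope.
Variables (m : nat) (F : groupType) (X : set F).
Hypotheses (m2 : 2 <= m) (freeF : free_of_rank m F) (genX : generating_set X).

(** The representation is faithful, and the image of [b] has a nonzero lower left entry, so
    transitivity is inherited from matrices. *)
Lemma free_commute_trans (b a c : F) : b <> 1 ->
  commute a b -> commute b c -> commute a c.
Proof.
have [e free_e] := freeF.
have [phi _ phi1] := free_representation val_inj free_e.
have inj_phi : injective phi.
  apply: gmulf_inj => x x1; apply/eqP/negPn/negP => /eqP/phi1.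
  by rewrite x1 mxE eqxx.
move=> b1 /(gmulf_commute phi) ab /(gmulf_commute phi) bc.
apply: inj_phi; rewrite !gmulfM; apply: val_inj.
by apply: (mx2_commute_trans (phi1 _ b1)); [move: ab|move: bc] => /(congr1 val).
Qed.

(** One of the first two basis elements serves as [g]: their images are the transvections with c = 0
    and c = 1 and parameter 'X. *)
Lemma free_conj_noncommute (a : F) : a <> 1 -> exists g, ~ commute a (a ^ g).
Proof.
have [e free_e] := freeF.
have [phi phie phi1] := free_representation val_inj free_e.
move=> /phi1 a10; apply/not_existsP => aC; move/eqP: a10; apply.
apply: (commute_transvection_conj (t := 'X%R)).
- by rewrite -polyC_natr polyC_eq0.
- by rewrite polyX_eq0.
move=> c c01 B.
have [i iE] : exists i : 'I_m, c = ((i : nat)%:Z%:P)%R.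
  case: c01 => ->; last by exists (Ordinal m2).
  by exists (Ordinal (ltnW m2)).
have -> : B = val (phi (a ^ e i)).
  by rewrite gmulfJ phie /B iE -transvectionV.
have : commute a (a ^ e i) by apply: contrapT; apply: aC.
by move/(gmulf_commute phi)/(congr1 val).
Qed.

(* Otherwise the centraliser of a is also that of b and of every b ^ x, hence is
   normalised by X, so that a commutes with all its conjugates. *)
Lemma free_noncommuting_conj (a b : F) : a <> 1 -> b <> 1 ->
  ~ commute a b \/ exists2 x, X x & ~ commute a (b ^ x).
Proof.
move=> a1 b1; apply: contrapT => /not_orP[/contrapT ab nex].
have abJ x : X x -> commute a (b ^ x).
  by move=> Xx; apply: contrapT => abC; apply: nex; exists x.
have [g] := free_conj_noncommute a1; apply.
have : subgroup_gen X g by rewrite (genX : subgroup_gen X = setT).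
move/(_ [set h | forall y, commute a y <-> commute a (y ^ h)]%classic).
move=> normC; have [|Cg _] := normC _ a; last exact/Cg/commute_refl.
split=> [|x Xx y].
  split=> [y|x y Cx Cy z|x Cx y]; first by rewrite conjg1.
    by rewrite conjgM -Cy.
  by rewrite (Cx (y ^ x^-1)) conjgKV.
have bJ1 : b ^ x <> 1 by apply/eqP; rewrite conjg_eq1; apply/eqP.
(* [y] commutes with [a] iff with [b], iff [y ^ x] commutes with [b ^ x], iff [y ^ x] commutes with
   [a]. *)
split=> [ay|ayx].
  apply: (free_commute_trans bJ1 (abJ x Xx)).
  rewrite /commute -!conjMg; congr (_ ^ x).
  by apply: (free_commute_trans a1); first exact: commute_sym.
apply: (free_commute_trans b1 ab).
have: commute (b ^ x) (y ^ x).
  by apply: (free_commute_trans a1); first exact/commute_sym/abJ.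
by rewrite /commute -!conjMg => /conjg_inj.
Qed.

End FreeCommutation.

(** * The lcm bound, from the balanced commutator of the given elements *)

Theorem proposition4p1 (m : nat) (F : groupType) (X : set F)
    (n d : nat) (gamma : 'I_n -> F) :
  (2 <= m)%N -> free_of_rank m F ->
  finite_set X -> generating_set X ->
  (1 <= n)%N ->
  (forall j : 'I_n, gamma j <> 1%g) ->
  (forall j : 'I_n, (word_length X (gamma j) <= d)%N) ->
  (lcm_length X (range gamma) <= 6 * d * n ^ 2)%N.
Proof.
move=> m2 freeF _ genX n1 gamma1 gammad.
have sz : size (codom gamma) = n by rewrite size_codom card_ord.
have [||e [e1 el eN]] := balanced_commutator genX
  (free_noncommuting_conj m2 freeF genX) (d := d) (s := codom gamma).
- by rewrite sz.
- by move=> _ /codomP[j ->].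
rewrite sz in el; apply: leq_trans (leq_trans (leq_addr _ _) el).
(* Membership in the normal closure is tested on every normal [N] containing the cyclic subgroup of
   [gamma j]. *)
apply: lcm_length_le => // _ [j _ <-] N [nN sN].
apply: (eN N (gamma j)) => //; first exact: codom_f.
by apply: sN => H [_]; apply.
Qed.
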